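(* Let $R_{n,k}$ be defined as in the context and $\mathcal{R}(x,y)=\sum_{n,k\ge0}\frac{R_{n,k}}{n!}x^ny^k$. Then \[\mathcal{R}(x,y)=\frac{\sqrt{y-1}}{\sqrt{y-1}\cos(x\sqrt{y-1})-\sin(x\sqrt{y-1})}.\]
   Context: For $n\ge1$, $S_n$ denotes the set of permutations of $\{0,1,\dots,n-1\}$ in one-line notation. A 3-dimensional permutation of length $n$ is a pair $\Pi=(\pi^2,\pi^3)$ of elements of $S_n$; its elements are the columns $\Pi_j=(\pi^2_j,\pi^3_j)^T$, $1\le j\le n$, and the level of $\Pi_j$ is $\max\{\pi^2_j,\pi^3_j\}$. Such $\Pi$ is canonical if $\pi^2=01\cdots(n-1)$. (Each level value is attained by at most two elements.) $R_{n,k}$ is the number of canonical 3-dimensional permutations of length $n$ in which exactly $k$ distinct level values are each attained by two elements; by convention $R_{0,0}=1$ and $R_{0,k}=0$ for $k\ge1$. The right-hand side is an even function of $\sqrt{y-1}$ and is understood as the corresponding formal power series in $x,y$. *)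

(* Defs.v *)
From HB Require Import structures.
From mathcomp Require Import all_boot all_order all_fingroup all_algebra.
From mathcomp Require Import boolp.

Set Implicit Arguments.
Unset Strict Implicit.
Unset Printing Implicit Defensive.

Import GRing.Theory Num.Theory.
Local Open Scope ring_scope.

(* {fps A} is A[[x]]; {fps {fps A}} is A[[y]][[x]] = A[[x, y]], the outer
   variable being x. *)

Record fps (A : Type) := Fps { fps_coef :> nat -> A }.

Notation "{ 'fps' A }" := (fps A) (at level 0, format "{ 'fps'  A }").

Lemma fpsP (A : Type) (f g : {fps A}) : f =1 g -> f = g.
Proof. by case: f g => [f] [g] /= /funext ->. Qed.

HB.instance Definition _ (A : Type) := gen_eqMixin {fps A}.
HB.instance Definition _ (A : Type) := gen_choiceMixin {fps A}.

Section FpsZmod.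
Variable A : zmodType.
Implicit Types f g h : {fps A}.

Definition fps_zero : {fps A} := Fps (fun=> 0).
Definition fps_opp f := Fps (fun n => - f n).
Definition fps_add f g := Fps (fun n => f n + g n).

Fact fps_addA : associative fps_add.
Proof. by move=> f g h; apply: fpsP => n /=; rewrite addrA. Qed.
Fact fps_addC : commutative fps_add.
Proof. by move=> f g; apply: fpsP => n /=; rewrite addrC. Qed.
Fact fps_add0 : left_id fps_zero fps_add.
Proof. by move=> f; apply: fpsP => n /=; rewrite add0r. Qed.
Fact fps_addN : left_inverse fps_zero fps_opp fps_add.
Proof. by move=> f; apply: fpsP => n /=; rewrite addNr. Qed.

HB.instance Definition _ :=
  GRing.isZmodule.Build {fps A} fps_addA fps_addC fps_add0 fps_addN.

End FpsZmod.

Section FpsRing.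
Variable A : comNzRingType.
Implicit Types f g h : {fps A}.

Definition fpsC (a : A) : {fps A} := Fps (fun n => if n == 0%N then a else 0).
Definition fpsX : {fps A} := Fps (fun n => (n == 1%N)%:R).
Definition fps_mul f g : {fps A} :=
  Fps (fun n => \sum_(i < n.+1) f i * g (n - i)%N).

Let tr m f : {poly A} := \poly_(i < m.+1) f i.

Let tr_mul m f g n : (n <= m)%N -> (tr m f * tr m g)`_n = fps_mul f g n.
Proof.
move=> lenm; rewrite coefM; apply: eq_bigr => i _; rewrite !coef_poly.
by rewrite !ltnS (leq_trans _ lenm) ?(leq_trans _ lenm) ?leq_subr // -ltnS.
Qed.

Let tr_tr m f n : (n <= m)%N -> f n = (tr m f)`_n.
Proof. by move=> lenm; rewrite coef_poly ltnS lenm. Qed.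

Fact fps_mulC : commutative fps_mul.
Proof. by move=> f g; apply: fpsP => n; rewrite -!(@tr_mul n) // mulrC. Qed.

Fact fps_mulA : associative fps_mul.
Proof.
move=> f g h; apply: fpsP => n.
transitivity ((tr n f * (tr n g * tr n h))`_n).
  rewrite coefM; apply: eq_bigr => i _; congr (_ * _).
    by apply: tr_tr; rewrite -ltnS.
  by rewrite tr_mul // leq_subr.
rewrite mulrA coefM; apply: eq_bigr => i _; congr (_ * _).
  by rewrite tr_mul // -ltnS.
by symmetry; apply: tr_tr; rewrite leq_subr.
Qed.

Fact fps_mul1 : left_id (fpsC 1) fps_mul.
Proof.
move=> f; apply: fpsP => n /=.
by rewrite big_ord_recl /= mul1r subn0 big1 ?addr0 // => i _; rewrite mul0r.
Qed.

Fact fps_mulD : left_distributive fps_mul +%R.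
Proof.
move=> f g h; apply: fpsP => n /=.
by rewrite -big_split; apply: eq_bigr => i _; rewrite mulrDl.
Qed.

Fact fps_oner_neq0 : fpsC 1 != 0.
Proof.
by apply/eqP => /(congr1 (fun f : {fps A} => f 0%N)) /= /eqP; rewrite oner_eq0.
Qed.

HB.instance Definition _ := GRing.Zmodule_isComNzRing.Build {fps A}
  fps_mulA fps_mulC fps_mul1 fps_mulD fps_oner_neq0.

Lemma fps_coefD f g n : (f + g) n = f n + g n. Proof. by []. Qed.
Lemma fps_coefN f n : (- f) n = - f n. Proof. by []. Qed.
Lemma fps_coefM f g n : (f * g) n = \sum_(i < n.+1) f i * g (n - i)%N.
Proof. by []. Qed.
Lemma fps_coef1 n : (1 : {fps A}) n = (n == 0%N)%:R.
Proof. by rewrite /=; case: eqP. Qed.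
Lemma fps_coefM0 f g : (f * g) 0%N = f 0%N * g 0%N.
Proof. by rewrite fps_coefM big_ord_recl big_ord0 addr0. Qed.

(* Substitution f(g); it has its usual meaning only when g has constant
   coefficient 0, in which case (g ^+ k) n = 0 for all k > n. *)
Definition fps_comp f g : {fps A} :=
  Fps (fun n => \sum_(k < n.+1) f k * (g ^+ k) n).

End FpsRing.

Arguments fpsX {A}.

Notation "f \oF g" := (fps_comp f g) (at level 50, left associativity).

Section CourseOfValues.
Variables (A : zmodType) (F : seq A -> A).

Fixpoint cov_seq n : seq A :=
  if n is m.+1 then rcons (cov_seq m) (F (cov_seq m)) else [::].

Definition cov : {fps A} := Fps (fun n => F (cov_seq n)).

Lemma cov_seqE n : cov_seq n = mkseq cov n.
Proof. by elim: n => //= n IHn; rewrite mkseqS -IHn. Qed.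

Lemma covE n : cov n = F (mkseq cov n).
Proof. by rewrite -cov_seqE. Qed.

End CourseOfValues.

Section FpsUnitRing.
Variable A : comUnitRingType.
Implicit Types f g : {fps A}.

Definition fps_unit : pred {fps A} := fun f => f 0%N \is a GRing.unit.

(* Solves f * g = 1 for g, coefficient by coefficient. *)
Definition fps_inv_step f (s : seq A) : A :=
  (f 0%N)^-1 * ((size s == 0)%N%:R - \sum_(i < size s) f (size s - i)%N * s`_i).

Definition fps_inv f : {fps A} :=
  if fps_unit f then cov (fps_inv_step f) else f.

Fact fps_mulV : {in fps_unit, left_inverse 1 fps_inv *%R}.
Proof.
move=> f Uf; have Uf0 : f 0%N \is a GRing.unit by [].
rewrite /fps_inv ifT //; have := covE (fps_inv_step f).
move: (cov _) => g gE; apply: fpsP => n.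
rewrite fps_coef1 mulrC fps_coefM big_ord_recl subn0 gE mulVKr //.
rewrite size_mkseq -[RHS](subrK (\sum_(i < n) f (n - i)%N * g i)).
congr (_ - _ + _); first by apply: eq_bigr => i _; rewrite nth_mkseq.
rewrite (reindex_inj rev_ord_inj); apply: eq_bigr => i _ /=.
by rewrite /bump add1n subnSK // subKn // ltnW.
Qed.

Fact fps_unitPl f g : g * f = 1 -> fps_unit f.
Proof.
move/(congr1 (fun h : {fps A} => h 0%N)); rewrite fps_coefM0 fps_coef1 => gf1.
by apply/unitrPr; exists (g 0%N); rewrite mulrC.
Qed.

Fact fps_inv_out : {in [predC fps_unit], fps_inv =1 id}.
Proof. by move=> f Uf; rewrite /fps_inv ifN. Qed.

HB.instance Definition _ := GRing.ComNzRing_hasMulInverse.Build {fps A}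
  fps_mulV fps_unitPl fps_inv_out.

Lemma fps_unitE f : (f \is a GRing.unit) = (f 0%N \is a GRing.unit).
Proof. by []. Qed.

Definition fps_cos : {fps A} :=
  Fps (fun n => if odd n then 0 else (-1) ^+ n./2 / n`!%:R).

Definition fps_sin : {fps A} :=
  Fps (fun n => if odd n then (-1) ^+ n./2 / n`!%:R else 0).

End FpsUnitRing.

Arguments fps_cos {A}.
Arguments fps_sin {A}.

(* The pair (pi^2, pi^3); columns are indexed from 0 by 'I_n. *)
Definition perm3 (n : nat) : Type := ('S_n * 'S_n)%type.

Section Perm3.
Variable n : nat.
Implicit Type P : perm3 n.

Definition level P (j : 'I_n) : nat := maxn (P.1 j) (P.2 j).

Definition canonical3 P : bool := [forall j, P.1 j == j].

(* Level values are < n, so they may be enumerated by 'I_n. *)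
Definition double_levels P : {set 'I_n} :=
  [set l : 'I_n | #|[set j | level P j == l]| == 2%N].

End Perm3.

Definition Rnk (n k : nat) : nat :=
  #|[set P : 'S_n * 'S_n | canonical3 P & #|double_levels P| == k]|.

Lemma Rnk0 k : Rnk 0 k = (k == 0%N).
Proof.
rewrite /Rnk (_ : [set _ | _] = if k == 0%N then [set 1%g] else set0).
  by case: eqP => _; rewrite ?cards1 ?cards0.
apply/setP=> P; rewrite inE (_ : double_levels P = set0); last first.
  by apply/setP => -[].
have -> : canonical3 P by apply/forallP => -[].
have -> : P = 1%g by case: P => p q; congr pair; apply/permP => -[].
by rewrite cards0 eq_sym /=; case: eqP => _; rewrite inE ?eqxx.
Qed.

Section GeneratingFunction.
Variable C : numClosedFieldType.

Definition var_x : {fps {fps C}} := fpsX.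
Definition var_y : {fps {fps C}} := fpsC fpsX.

Definition Rgf : {fps {fps C}} :=
  Fps (fun n => Fps (fun k => (Rnk n k)%:R / n`!%:R)).

(* y - 1 does have a square root in C[[x, y]], since its constant coefficient
   -1 is a square in C. *)
Lemma sqrt_yB1_exists : exists s : {fps {fps C}}, s ^+ 2 = var_y - 1.
Proof.
pose c : {fps C} := fpsX - 1.
pose F (t : seq C) : C :=
  if size t is m.+1
  then (c (size t) - \sum_(i < m) t`_i.+1 * t`_(m - i)) / (2 * 'i) else 'i.
have [g gE] : exists g : {fps C}, forall n, g n = F (mkseq g n).
  by exists (cov F); apply: covE.
have g0 : g 0%N = 'i by rewrite gE.
have s2 : g ^+ 2 = c.
  apply: fpsP => -[|n]; rewrite expr2.
    by rewrite fps_coefM0 -expr2 g0 sqrCi /= add0r.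
  rewrite fps_coefM big_ord_recl big_ord_recr /= subn0 g0.
  rewrite [bump 0 n]add1n subnn g0 [g n.+1]gE /F size_mkseq.
  set S := \sum_(i < n) (mkseq _ _)`_i.+1 * _.
  set T := \sum_(i < n) _; have -> : T = S.
    apply: eq_bigr => i _; rewrite [bump _ _]add1n subSS.
    by rewrite !nth_mkseq // ltnS ?leq_subr.
  transitivity (S + (c n.+1 - S)); last by rewrite subrKC.
  rewrite addrCA; congr (S + _).
  rewrite mulrC -mulrDr -[X in _ * X](mulr_natl 'i 2).
  by rewrite divfK // mulf_neq0 ?pnatr_eq0 ?neq0Ci.
exists (fpsC g); apply: fpsP => -[|n].
  by rewrite expr2 fps_coefM0 -expr2 /= s2.
rewrite expr2 fps_coefM big_ord_recl /= big1 ?addr0 => [|i _]; last by rewrite mul0r.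
by rewrite mulr0 subr0.
Qed.

Lemma denominator_unit (s : {fps {fps C}}) : s ^+ 2 = var_y - 1 ->
  s * (fps_cos \oF (var_x * s)) - (fps_sin \oF (var_x * s)) \is a GRing.unit.
Proof.
move=> s2; have Us : s \is a GRing.unit.
  rewrite -(@unitrX_pos _ s 2) // s2 !fps_unitE /= !add0r.
  by rewrite unitrN unitr1.
rewrite fps_unitE fps_coefD fps_coefN fps_coefM0 /= !big_ord_recl !big_ord0.
rewrite !expr0 /= fact0 divr1 mul0r !mulr1 !addr0 subr0.
by rewrite mulr1 -fps_unitE.
Qed.

End GeneratingFunction.

Arguments var_x {C}.
Arguments var_y {C}.
Arguments Rgf {C}.

(* Main.v *)
(* For the canonical permutation (id, p), the level l is attained twice exactly
   when p l < l and p^-1 l < l, that is, when l is a cyclic peak of p.  Inserting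
   a new maximum into a permutation of length n with k cyclic peaks, either as a
   fixed point or on one of the n arcs i -> p i of its cycles, keeps k for the
   fixed point and for the 2k arcs that touch a peak, and increases it by 1
   otherwise.  Hence R_(n+1,k) = (2k+1) R_(n,k) + (n-2k+2) R_(n,k-1), a first-order
   linear PDE for the generating function; the closed form solves the same PDE,
   because s is constant in x and 2 s ds/dy = 1, and has the same constant term
   in x. *)

From HB Require Import structures.
Require Import Defs.
From mathcomp Require Import all_boot all_order all_fingroup all_algebra.
From mathcomp Require Import ring.
Import GRing.Theory Num.Theory.
Local Open Scope ring_scope.
Set Implicit Arguments.
Unset Strict Implicit.
Unset Printing Implicit Defensive.

(** * Doubled levels, cyclic peaks and insertion of a new maximum *)

Section CyclicPeaks.
Local Open Scope group_scope.
Local Open Scope nat_scope.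

Definition cpeaks n (p : 'S_n) : {set 'I_n} :=
  [set l : 'I_n | (p l < l)%N && (p^-1 l < l)%N].

(** Column [j] has level the maximum of [j] and [p j], so only [j = l] and [j = p^-1 l] can have
    level [l]; they do when [p l <= l] and [p^-1 l <= l] respectively. They differ unless [l] is a
    fixed point, whose level is attained once. *)
Lemma double_levels_cpeaks n (p : 'S_n) : double_levels (1%g, p) = cpeaks p.
Proof.
apply/setP => l; rewrite !inE /level /=.
have lvlE j : (maxn ((1%g : 'S_n) j) (p j) == l :> nat) =
    (j \in [set j | ((j == l) && (p l <= l)) || ((j == p^-1 l) && (j <= l))])%N.
  rewrite inE perm1; apply/eqP/orP.
    case: (leqP j (p j)) => [le_j /val_inj <-|lt_j /val_inj <-].
      by right; rewrite permK eqxx.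
    by left; rewrite eqxx ltnW.
  case=> /andP [/eqP -> le_l]; first by apply/maxn_idPl.
  by rewrite permKV; apply/maxn_idPr.
have -> : [set j | maxn ((1%g : 'S_n) j) (p j) == l] =
    [set j | ((j == l) && (p l <= l)) || ((j == p^-1 l) && (j <= l))]%N.
  by apply/setP => j; rewrite [LHS]inE lvlE.
have [pl|npl] := eqVneq (p l) l.
  have pVl : p^-1 l = l by rewrite -{1}pl permK.
  rewrite pVl pl ltnn /= (_ : [set _ | _] = [set l]) ?cards1 //.
  by apply/setP => j; rewrite !inE leqnn; case: eqP => //= ->; rewrite leqnn.
have npVl : p^-1 l != l by apply: contraNneq npl => {1}<-; rewrite permKV.
rewrite !ltn_neqAle npl npVl /=.
have [le1|gt1] := leqP (p l) l; have [le2|gt2] := leqP (p^-1 l) l => /=.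
- rewrite (_ : [set _ | _] = [set l; p^-1 l]) ?cards2 ?[l == _]eq_sym ?npVl //.
  apply/setP => j; rewrite !inE andbT; case: eqP => //= _.
  by case: eqP => //= ->.
- rewrite (_ : [set _ | _] = [set l]) ?cards1 //.
  apply/setP => j; rewrite !inE andbT; case: eqP => //= _.
  by case: eqP => //= ->; rewrite leqNgt gt2.
- rewrite (_ : [set _ | _] = [set p^-1 l]) ?cards1 //.
  apply/setP => j; rewrite !inE andbF; case: eqP => //= ->.
  by rewrite le2.
- rewrite (_ : [set _ | _] = set0) ?cards0 //.
  apply/setP => j; rewrite !inE andbF; case: eqP => //= ->.
  by rewrite leqNgt gt2.
Qed.

Lemma Rnk_cpeaks n k : Rnk n k = #|[set p : 'S_n | #|cpeaks p| == k]|.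
Proof.
rewrite -(card_imset _ (f := fun p : 'S_n => (1%g : 'S_n, p))); last by move=> p q [].
apply: eq_card => -[q p]; rewrite !inE; apply/andP/imsetP.
  case=> /forallP /= qid; have -> : q = 1%g.
    by apply/permP => j; rewrite perm1; apply/eqP/qid.
  by rewrite double_levels_cpeaks => pk; exists p; rewrite ?inE.
case=> r; rewrite inE => pk [-> ->]; split; last by rewrite double_levels_cpeaks.
by apply/forallP => j /=; rewrite perm1.
Qed.

(* Inserts the new maximum right after [a] in its cycle; [a = ord_max] makes
   it a fixed point. *)
Definition cinsert n (u : 'I_n.+1 * 'S_n) : 'S_n.+1 :=
  (tperm u.1 ord_max * lift_perm ord_max ord_max u.2)%g.

(** The insertion point is recovered as the preimage of [ord_max], then [p] by cancelling the
    transposition; injectivity suffices since (n+1) n! = (n+1)!. *)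
Lemma cinsert_bij n : bijective (@cinsert n).
Proof.
apply: inj_card_bij; last by rewrite card_prod !card_ord !card_Sn factS.
move=> [a p] [b q] /= eq_ins.
have ins_max c (r : 'S_n) : cinsert (c, r) c = ord_max.
  by rewrite permM tpermL lift_perm_id.
have ab : a = b.
  by apply: (@perm_inj _ (cinsert (b, q))); rewrite -{1}eq_ins !ins_max.
move: eq_ins; rewrite ab => /mulgI eq_lift; congr (_, _).
apply/permP => j; apply: (@lift_inj _ ord_max).
by rewrite -!(lift_perm_lift ord_max ord_max) eq_lift.
Qed.

Let lift_max n (j : 'I_n) : lift ord_max j = j :> nat.
Proof. by rewrite /= /bump leqNgt ltn_ord. Qed.

Lemma card_cpeaks_cinsert_max n (p : 'S_n) :
  #|cpeaks (cinsert (ord_max, p))| = #|cpeaks p|.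
Proof.
rewrite -[RHS](card_imset _ (@lift_inj _ ord_max)); apply: eq_card => l.
rewrite /cinsert tperm1 mul1g; case: (unliftP ord_max l) => [j|] ->.
  rewrite (mem_imset _ _ (@lift_inj _ ord_max)) !inE.
  by rewrite lift_permV !lift_perm_lift !lift_max.
rewrite inE lift_perm_id ltnn; apply/esym/imsetP => -[j _ /eqP].
by rewrite (negPf (neq_lift _ _)).
Qed.

(** Keeps the arcs at different peaks distinct, so that k peaks touch exactly 2k arcs. *)
Lemma cpeaks_succ n (p : 'S_n) i : i \in cpeaks p -> p i \notin cpeaks p.
Proof.
rewrite !inE => /andP [lt_p _]; rewrite permK negb_and -!leqNgt.
by rewrite (ltnW lt_p) orbT.
Qed.

(* The points after which inserting a new maximum destroys a cyclic peak. *)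
Definition near_cpeak n (p : 'S_n) : {set 'I_n} := cpeaks p :|: p @^-1: cpeaks p.

Lemma card_near_cpeak n (p : 'S_n) : #|near_cpeak p| = (#|cpeaks p|).*2.
Proof.
rewrite /near_cpeak cardsU (_ : _ :&: _ = set0) ?cards0 ?subn0.
  rewrite -addnn; congr addn; exact/card_preimset/perm_inj.
apply/setP => i; rewrite !inE /=; apply/negP => /andP [pi ppi].
by have := @cpeaks_succ _ p i; rewrite !inE pi => /(_ isT); rewrite ppi.
Qed.

(** The new maximum is a peak and exceeds its neighbours [i] and [p i], which are therefore no peaks
    any more; all other points keep their neighbours. *)
Lemma card_cpeaks_cinsert n (p : 'S_n) (i : 'I_n) :
  #|cpeaks (cinsert (lift ord_max i, p))| = (#|cpeaks p| + (i \notin near_cpeak p))%N.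
Proof.
set q := cinsert _.
have qi : q (lift ord_max i) = ord_max by rewrite permM tpermL lift_perm_id.
have qmax : q ord_max = lift ord_max (p i) by rewrite permM tpermR lift_perm_lift.
have qj j : j != i -> q (lift ord_max j) = lift ord_max (p j).
  move=> ji; rewrite permM tpermD ?lift_perm_lift ?neq_lift //.
  by rewrite (inj_eq (@lift_inj _ _)) eq_sym.
have -> : cpeaks q = ord_max |: lift ord_max @: (cpeaks p :\ i :\ p i).
  apply/setP => l; rewrite in_setU1; case: (unliftP ord_max l) => [j|] ->.
    rewrite eq_sym (negPf (neq_lift _ _)) (mem_imset _ _ (@lift_inj _ _)) !inE.
    have [->|ji] := eqVneq j i.
      by rewrite qi lift_max [X in X && _]ltnNge (ltnW (ltn_ord _)) /= andbF.
    rewrite (qj _ ji) !lift_max /=; have [->|jpi] := eqVneq j (p i).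
      by rewrite -[X in q^-1 X]qmax permK /= [X in _ && X]ltnNge (ltnW (ltn_ord _)) andbF.
    have -> : q^-1 (lift ord_max j) = lift ord_max (p^-1 j).
      apply: (canLR (permK q)); rewrite qj ?permKV //.
      by apply: contraNneq jpi => <-; rewrite permKV.
    by rewrite lift_max.
  by rewrite eqxx inE qmax -[X in q^-1 X]qi permK !lift_max !ltn_ord.
rewrite cardsU1 (card_imset _ (@lift_inj _ _)).
have -> /= : ord_max \notin lift ord_max @: (cpeaks p :\ i :\ p i).
  by apply/imsetP => -[j _ /eqP]; rewrite (negPf (neq_lift _ _)).
(* At most one of [i] and [p i] is a peak, so the deletions cost one peak exactly when [i] is in
   [near_cpeak p]; the new peak then makes up for it. *)
have := @cpeaks_succ _ p i.
rewrite (cardsD1 i (cpeaks p)) (cardsD1 (p i) (cpeaks p :\ i)) in_setD1.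
rewrite /near_cpeak in_setU [i \in _ @^-1: _]inE.
have [pi /(_ isT) /negPf ppi|npi _] := boolP (i \in cpeaks p).
  by rewrite ppi andbF addnC addn0.
have [->|_] := eqVneq (p i) i; first by rewrite (negPf npi) addnC.
by case: (p i \in _); rewrite ?addn0 ?addn1.
Qed.

(** If [p] has k peaks, n - 2k arcs avoid them; the term with [k.*2] stands on the left to avoid
    truncated subtraction. *)
Lemma sum_cpeaks_cinsert n (p : 'S_n) k :
  \sum_(a < n.+1) (#|cpeaks (cinsert (a, p))| == k.+1) + k.*2 * (#|cpeaks p| == k)
    = k.+1.*2.+1 * (#|cpeaks p| == k.+1) + n * (#|cpeaks p| == k).
Proof.
rewrite (bigD1_ord ord_max) //= card_cpeaks_cinsert_max.
under eq_bigr do rewrite card_cpeaks_cinsert.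
rewrite (bigID (fun i => i \in near_cpeak p)) /=.
rewrite (eq_bigr (fun=> #|cpeaks p| == k.+1 : nat)); last by move=> i ->; rewrite addn0.
rewrite [X in _ + (_ + X)](eq_bigr (fun=> #|cpeaks p| == k : nat)); last first.
  by move=> i ->; rewrite addn1 eqSS.
rewrite !sum_nat_const card_near_cpeak.
have -> : #|[pred i | i \notin near_cpeak p]| = n - (#|cpeaks p|).*2.
  by apply: (canRL (addKn _)); rewrite -card_near_cpeak cardC card_ord.
(* With this bound the subtraction from [n] is not truncated. *)
have : (#|cpeaks p|).*2 <= n.
  by rewrite -card_near_cpeak (leq_trans (max_card _)) ?card_ord.
have [-> le_n|_ _] := eqVneq #|cpeaks p| k.
  by rewrite (ltn_eqF (ltnSn k)) !muln0 !muln1 !add0n subnK.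
by rewrite !muln0 !addn0; case: eqP => [->|_]; rewrite ?muln1 ?muln0 ?addn0 ?add1n.
Qed.

(** Insertion on an arc always leaves a peak, the new maximum, so only the fixed point
    contributes. *)
Lemma sum_cpeaks_cinsert0 n (p : 'S_n) :
  \sum_(a < n.+1) (#|cpeaks (cinsert (a, p))| == 0) = (#|cpeaks p| == 0).
Proof.
rewrite (bigD1_ord ord_max) //= card_cpeaks_cinsert_max.
rewrite big1 ?addn0 // => i _; rewrite card_cpeaks_cinsert addn_eq0.
case: eqP => //= p0; have := card_near_cpeak p.
by rewrite p0 => /eqP; rewrite cards_eq0 => /eqP ->; rewrite in_set0.
Qed.

(** * The recurrence for [Rnk] *)

Lemma Rnk_sum n k : Rnk n k = \sum_(p : 'S_n) (#|cpeaks p| == k).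
Proof. by rewrite Rnk_cpeaks cardsE -sum1_card big_mkcond. Qed.

Lemma Rnk_sum_cinsert n k :
  Rnk n.+1 k = \sum_(p : 'S_n) \sum_(a < n.+1) (#|cpeaks (cinsert (a, p))| == k).
Proof.
rewrite Rnk_sum (reindex _ (onW_bij _ (@cinsert_bij n))) exchange_big pair_bigA /=.
by apply: eq_bigr => -[].
Qed.

Lemma RnkSS n k :
  Rnk n.+1 k.+1 + k.*2 * Rnk n k = k.+1.*2.+1 * Rnk n k.+1 + n * Rnk n k.
Proof.
rewrite Rnk_sum_cinsert !Rnk_sum !big_distrr -!big_split /=.
by apply: eq_bigr => p _; apply: sum_cpeaks_cinsert.
Qed.

Lemma RnkS0 n : Rnk n.+1 0 = Rnk n 0.
Proof.
rewrite Rnk_sum_cinsert Rnk_sum.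
by apply: eq_bigr => p _; apply: sum_cpeaks_cinsert0.
Qed.

End CyclicPeaks.

(** * Derivations of a commutative ring and of its power series *)

Section Derivations.
Variables (A : comNzRingType) (d : {additive A -> A}).
Hypothesis dM : forall a b, d (a * b) = d a * b + a * d b.

Lemma derivation1 : d 1 = 0.
Proof. by apply: (addrI (d 1)); rewrite addr0 -{3}[1]mulr1 dM mulr1 mul1r. Qed.

Lemma derivation_nat n : d n%:R = 0.
Proof. by rewrite raddfMn derivation1 mul0rn. Qed.

(** Multiplying the power rule by [a] avoids the exponent n - 1, also at n = 0. *)
Lemma derivationX a n : a * d (a ^+ n) = a ^+ n * d a *+ n.
Proof.
elim: n => [|n IHn]; first by rewrite expr0 derivation1 mulr0 mulr0n.
by rewrite exprS dM mulrDr [a * (a * _)]mulrCA IHn mulrnAr [in RHS]mulrS; ring.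
Qed.

End Derivations.

Lemma derivationV (A : comUnitRingType) (d : {additive A -> A}) a :
  (forall a b, d (a * b) = d a * b + a * d b) ->
  a \is a GRing.unit -> d a = 0 -> d a^-1 = 0.
Proof.
move=> dM Ua da; apply: (mulrI Ua); rewrite mulr0.
by have := dM a a^-1; rewrite divrr // (derivation1 dM) da mul0r add0r.
Qed.

Section FpsDerivations.
Variable A : comNzRingType.
Implicit Types f g : {fps A}.

Definition fps_deriv f : {fps A} := Fps (fun n => f n.+1 *+ n.+1).

Fact fps_deriv_additive : zmod_morphism fps_deriv.
Proof. by move=> f g; apply: fpsP => n /=; rewrite mulrnBl. Qed.

HB.instance Definition _ :=
  GRing.isZmodMorphism.Build {fps A} {fps A} fps_deriv fps_deriv_additive.

Lemma fps_derivM f g : fps_deriv (f * g) = fps_deriv f * g + f * fps_deriv g.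
Proof.
apply: fpsP => n; rewrite fps_coefD !fps_coefM /= -sumrMnl.
transitivity (\sum_(i < n.+2) (f i *+ i * g (n.+1 - i)%N +
                               f i * (g (n.+1 - i)%N *+ (n.+1 - i)))).
  apply: eq_bigr => i _; rewrite mulrnAl mulrnAr -mulrnDr subnKC //.
  by rewrite -ltnS.
rewrite big_split /=; congr (_ + _).
  by rewrite big_ord_recl /= mulr0n mul0r add0r.
rewrite big_ord_recr /= subnn mulr0n mulr0 addr0.
by apply: eq_bigr => i _ /=; rewrite subSn // -ltnS.
Qed.

Variable d : {additive A -> A}.
Hypothesis dM : forall a b, d (a * b) = d a * b + a * d b.

(** When [d] is the derivative in the inner variable, this is the partial derivative in y. *)
Definition fps_map f : {fps A} := Fps (fun n => d (f n)).

Fact fps_map_additive : zmod_morphism fps_map.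
Proof. by move=> f g; apply: fpsP => n /=; rewrite raddfB. Qed.

HB.instance Definition _ :=
  GRing.isZmodMorphism.Build {fps A} {fps A} fps_map fps_map_additive.

Lemma fps_mapM f g : fps_map (f * g) = fps_map f * g + f * fps_map g.
Proof.
apply: fpsP => n; rewrite fps_coefD !fps_coefM /= raddf_sum -big_split.
by apply: eq_bigr => i _; rewrite /= dM.
Qed.

End FpsDerivations.

(** * Coefficients, and substitution of a constant multiple of the variable *)

Section FpsCoef.
Variable A : comNzRingType.
Implicit Types f g : {fps A}.

Lemma fps_coefCM (a : A) f n : (fpsC a * f) n = a * f n.
Proof.
rewrite fps_coefM big_ord_recl /= subn0 big1 ?addr0 // => i _.
by rewrite mul0r.
Qed.

Lemma fps_coefXM f n : (fpsX * f) n = if n is m.+1 then f m else 0.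
Proof.
rewrite fps_coefM; case: n => [|n]; first by rewrite big_ord1 mul0r.
rewrite big_ord_recl mul0r add0r big_ord_recl /= mul1r subSS subn0.
by rewrite big1 ?addr0 // => i _; rewrite mul0r.
Qed.

Lemma fps_coef_expXC (a : A) k n :
  ((fpsX * fpsC a) ^+ k) n = if n == k then a ^+ k else 0.
Proof.
elim: k n => [|k IHk] n; first by rewrite expr0 fps_coef1; case: eqP.
rewrite exprS -mulrA fps_coefXM; case: n => // n.
by rewrite fps_coefCM IHk eqSS; case: eqP => _; rewrite ?mulr0 ?exprS.
Qed.

Lemma fps_coef_compXC f (a : A) n : (f \oF (fpsX * fpsC a)) n = f n * a ^+ n.
Proof.
rewrite /= big_ord_recr /= fps_coef_expXC eqxx big1 ?add0r // => i _.
by rewrite fps_coef_expXC eq_sym (ltn_eqF (ltn_ord i)) mulr0.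
Qed.

Lemma fps_derivX : fps_deriv fpsX = 1 :> {fps A}.
Proof. by apply: fpsP => -[|n]; rewrite fps_coef1 /= ?mul0rn. Qed.

Lemma fps_coefX_deriv f n : (fpsX * fps_deriv f) n = f n *+ n.
Proof. by rewrite fps_coefXM; case: n. Qed.

(** Chain rule: the coefficient of degree n is [f n * a ^+ n], where [d] kills [f n], and
    [fpsX * fps_deriv] multiplies it by n. The factor [a] on the left replaces a division by [a]. *)
Lemma fps_map_compXC (d : {additive A -> A}) f (a : A) :
  (forall a b, d (a * b) = d a * b + a * d b) -> fps_map d f = 0 ->
  fpsC a * fps_map d (f \oF (fpsX * fpsC a)) =
    fpsC (d a) * (fpsX * fps_deriv (f \oF (fpsX * fpsC a))).
Proof.
move=> dM df; apply: fpsP => n; rewrite !fps_coefCM fps_coefX_deriv.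
rewrite -[fps_map _ _ n]/(d (_ n)) fps_coef_compXC dM -[d (f n)]/(fps_map d f n) df.
by rewrite mul0r add0r mulrCA derivationX // !mulrnAr; congr (_ *+ _); ring.
Qed.

Lemma fps_deriv_compXC f (a : A) :
  fps_deriv (f \oF (fpsX * fpsC a)) = fpsC a * (fps_deriv f \oF (fpsX * fpsC a)).
Proof.
apply: fpsP => n; rewrite fps_coefCM fps_coef_compXC.
rewrite -[LHS]/((f \oF (fpsX * fpsC a)) n.+1 *+ n.+1) fps_coef_compXC /=.
by rewrite exprS mulrnAl mulrCA mulrnAr.
Qed.

Lemma fps_derivC (a : A) : fps_deriv (fpsC a) = 0.
Proof. by apply: fpsP => n /=; rewrite mul0rn. Qed.

Lemma fps_mapC (d : {additive A -> A}) (a : A) : fps_map d (fpsC a) = fpsC (d a).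
Proof. by apply: fpsP => n /=; case: eqP => // _; rewrite raddf0. Qed.

Lemma fps_coefMn f k n : (f *+ k) n = f n *+ k.
Proof. by elim: k => [|k IHk]; rewrite ?mulr0n // !mulrS fps_coefD IHk. Qed.

Lemma fps_coef_nat k n : (k%:R : {fps A}) n = (n == 0%N)%:R *+ k.
Proof. by rewrite fps_coefMn fps_coef1. Qed.

Lemma fps_compN f g : (- f) \oF g = - (f \oF g).
Proof.
apply: fpsP => n /=; rewrite -sumrN.
by apply: eq_bigr => i _; rewrite mulNr.
Qed.

End FpsCoef.

(** * Derivatives of cosine and sine *)

Section SinCos.
Variable A : comUnitRingType.
Hypothesis unit_nat : forall n, n.+1%:R \is a @GRing.unit A.

Let factS_inv n : (n.+1)`!%:R^-1 *+ n.+1 = n`!%:R^-1 :> A.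
Proof.
have Un : n`!%:R \is a @GRing.unit A by rewrite -(prednK (fact_gt0 n)) unit_nat.
by rewrite factS natrM invrM // -[LHS]mulr_natr divrK.
Qed.

Lemma fps_deriv_cos : fps_deriv fps_cos = - fps_sin :> {fps A}.
Proof.
apply: fpsP => n; rewrite fps_coefN /= uphalf_half; case: (odd n); last by rewrite mul0rn oppr0.
by rewrite -mulrnAr factS_inv exprS mulN1r mulNr.
Qed.

Lemma fps_deriv_sin : fps_deriv fps_sin = fps_cos :> {fps A}.
Proof.
apply: fpsP => n /=; rewrite uphalf_half; case: (odd n); first by rewrite mul0rn.
by rewrite -mulrnAr factS_inv add0n.
Qed.

Variable d : {additive A -> A}.
Hypothesis dM : forall a b, d (a * b) = d a * b + a * d b.

Let d_cst k n : d ((-1) ^+ k / n`!%:R) = 0.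
Proof.
have Un : n`!%:R \is a @GRing.unit A by rewrite -(prednK (fact_gt0 n)).
rewrite dM (derivationV dM Un) ?derivation_nat // mulr0 addr0.
have := derivationX dM (-1) k.
rewrite mulN1r raddfN (derivation1 dM) oppr0 mulr0 mul0rn => /eqP.
by rewrite oppr_eq0 => /eqP ->; rewrite mul0r.
Qed.

Lemma fps_map_cos : fps_map d fps_cos = 0.
Proof. by apply: fpsP => n /=; case: ifP => _; rewrite ?raddf0 ?d_cst. Qed.

Lemma fps_map_sin : fps_map d fps_sin = 0.
Proof. by apply: fpsP => n /=; case: ifP => _; rewrite ?raddf0 ?d_cst. Qed.

End SinCos.

(** * The differential equation and its two solutions *)

Section GeneratingFunction.
Variable C : numClosedFieldType.
Implicit Types F G s : {fps {fps C}}.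

Local Notation dx := (@fps_deriv {fps C}).
Local Notation dy := (fps_map (@fps_deriv C)).

Let dxM F G : dx (F * G) = dx F * G + F * dx G.
Proof. exact: fps_derivM. Qed.

Let dyM F G : dy (F * G) = dy F * G + F * dy G.
Proof. exact/fps_mapM/fps_derivM. Qed.

Lemma fps_unit_nat n : n.+1%:R \is a @GRing.unit {fps C}.
Proof. by rewrite fps_unitE fps_coef_nat unitfE pnatr_eq0. Qed.

(* (1 - x y) dF/dx = F + 2 y (1 - y) dF/dy, the recurrence RnkSS read on the
   exponential generating function. *)
Definition Rpde F :=
  dx F = F + var_y * (var_x * dx F) + (var_y * dy F) *+ 2
           - (var_y * (var_y * dy F)) *+ 2.

Lemma Rpde_coef F n : Rpde F ->
  F n.+1 *+ n.+1 = F n + (fpsX * F n) *+ n + (fpsX * fps_deriv (F n)) *+ 2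
                   - (fpsX * (fpsX * fps_deriv (F n))) *+ 2.
Proof.
move/(congr1 (fun G : {fps {fps C}} => G n)).
rewrite -[LHS]/(F n.+1 *+ n.+1) => ->.
rewrite !fps_coefD fps_coefN !fps_coefMn !fps_coefCM.
by rewrite fps_coefX_deriv mulrnAr.
Qed.

(** At degree n in x the equation expresses [F n.+1 *+ n.+1] through [F n], and [n.+1] is
    invertible. *)
Lemma Rpde_inj F G : F 0%N = G 0%N -> Rpde F -> Rpde G -> F = G.
Proof.
move=> FG0 pF pG; apply: fpsP; elim=> // n IHn.
apply: (mulrI (fps_unit_nat n)); rewrite !mulr_natl.
by rewrite (Rpde_coef n pF) (Rpde_coef n pG) IHn.
Qed.

Lemma Rpde_Rgf : Rpde Rgf.
Proof.
apply: fpsP => n; rewrite !fps_coefD fps_coefN !fps_coefMn !fps_coefCM.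
rewrite fps_coefX_deriv -[dx _ n]/(Rgf n.+1 *+ n.+1) -[dy _ n]/(fps_deriv (Rgf n)).
apply: fpsP => k; rewrite !fps_coefD fps_coefN !fps_coefMn.
rewrite mulrnAr fps_coefMn [(fpsX * (fpsX * _)) k]fps_coefXM !fps_coefX_deriv.
rewrite fps_coefXM.
(* The factor m+1 from the x-derivative turns the denominator (m+1)! into m!. *)
have RnkE m : Rgf m.+1 k *+ m.+1 = (Rnk m.+1 k)%:R / m`!%:R :> C.
  rewrite /= -mulrnAr; congr (_ * _); apply: (mulrI (_ : m`!%:R \is a GRing.unit)).
    by rewrite unitfE pnatr_eq0 -lt0n fact_gt0.
  rewrite divrr ?unitfE ?pnatr_eq0 -?lt0n ?fact_gt0 // mulrnAr -mulrnAl -mulr_natr -natrM.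
  by rewrite mulnC -factS divrr // unitfE pnatr_eq0 -lt0n fact_gt0.
rewrite RnkE; case: k RnkE => [|k] _.
  by rewrite RnkS0 mul0rn mulr0n !mul0rn !addr0 subr0.
rewrite fps_coefX_deriv /=.
rewrite -!mulrnAl -!mulrDl -mulrBl; congr (_ / _).
(* Adding 2k R_(n,k) to both sides gives the subtraction-free form of [RnkSS]. *)
apply: (addIr ((k.*2 * Rnk n k)%:R)); rewrite -natrD RnkSS.
rewrite -!mulrnA -!natrD [(k.*2 * _)%N]mulnC -[k.*2]muln2 subrK; congr _%:R; rewrite -?muln2; ring.
Qed.

Lemma sqrt_yB1_unit s : s ^+ 2 = var_y - 1 -> s \is a GRing.unit.
Proof.
move=> s2; rewrite -(@unitrX_pos _ s 2) // s2 !fps_unitE /= !add0r.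
by rewrite unitrN unitr1.
Qed.

(** Differentiating the hypothesis in x gives 2 s ds/dx = 0, where 2 and s are invertible. Thus
    [var_x * s] is a constant multiple of x, as the substitution lemmas require. *)
Lemma sqrt_yB1_const s : s ^+ 2 = var_y - 1 -> s = fpsC (s 0%N).
Proof.
move=> s2; have Us := sqrt_yB1_unit s2.
have : s * dx s *+ 2 = 0.
  have := congr1 dx s2; rewrite raddfB (derivation1 dxM) subr0 [RHS]fps_derivC expr2 dxM.
  by rewrite mulr2n [in X in X + _]mulrC.
rewrite -mulrnAr => /(canRL (mulKr Us)); rewrite mulr0 => ds.
apply: fpsP => -[|n] //=; apply: (mulrI (fps_unit_nat n)).
have /(congr1 (fun F : {fps {fps C}} => F n)) := ds.
rewrite mulr2n fps_coefD /= -mulrnDr mulr0 mulr_natl => sn.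
apply: (mulrI (fps_unit_nat 1)); rewrite mulr0 mulr_natl -mulrnA -[RHS]sn.
by rewrite muln2 addnn.
Qed.

(** With g the quotient and D its denominator, differentiating g D = s yields both partial
    derivatives of g, multiplied by D; multiplied by D^2, the equation becomes a polynomial
    identity. *)
Lemma Rpde_closed s : s ^+ 2 = var_y - 1 ->
  Rpde (s / (s * (fps_cos \oF (var_x * s)) - (fps_sin \oF (var_x * s)))).
Proof.
move=> s2; move: (denominator_unit s2).
have Us := sqrt_yB1_unit s2.
have sC := sqrt_yB1_const s2.
have cx : dx (fps_cos \oF (var_x * s)) = - (s * (fps_sin \oF (var_x * s))).
  by rewrite sC /var_x fps_deriv_compXC (fps_deriv_cos fps_unit_nat) fps_compN mulrN.
have sx : dx (fps_sin \oF (var_x * s)) = s * (fps_cos \oF (var_x * s)).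
  by rewrite sC /var_x fps_deriv_compXC (fps_deriv_sin fps_unit_nat).
have s_x : dx s = 0 by rewrite sC fps_derivC.
have s_y : s * dy s *+ 2 = 1.
  have := congr1 dy s2; rewrite raddfB (derivation1 dyM) subr0 [RHS]fps_mapC /= fps_derivX.
  by rewrite expr2 dyM [dy s * s]mulrC -mulr2n.
have chain F : dy F = 0 ->
    s * dy (F \oF (var_x * s)) = dy s * (var_x * dx (F \oF (var_x * s))).
  move=> F0; rewrite sC fps_map_compXC ?fps_mapC //; exact: fps_derivM.
have := chain _ (fps_map_cos fps_unit_nat (@fps_derivM C)).
have := chain _ (fps_map_sin fps_unit_nat (@fps_derivM C)).
rewrite cx sx; move: cx sx.
move: (fps_cos \oF _) (fps_sin \oF _) => c t cx tx /esym ty /esym cy UD.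
have {}cy : dy c = - (dy s * (var_x * t)).
  by apply: (mulrI Us); rewrite -cy; ring.
have {}ty : dy t = dy s * (var_x * c).
  by apply: (mulrI Us); rewrite -ty; ring.
set D := s * c - t in UD *; set g := s / D.
have gD : g * D = s by rewrite /g divrK.
have Dx : dx D = - (s * (s * t + c)).
  by rewrite raddfB /= dxM s_x cx tx; ring.
have Dy : dy D = dy s * (c - var_x * (s * t + c)).
  by rewrite raddfB /= dyM cy ty; ring.
have gx : dx g * D = g * (s * (s * t + c)).
  by apply/eqP; rewrite -subr_eq0 -mulrN -Dx -dxM gD s_x.
have gy : s * dy g *+ 2 * D = 1 - g * (c - var_x * (s * t + c)).
  have := dyM g D; rewrite gD Dy => /(congr1 (fun F => s * F *+ 2)).
  rewrite s_y => e; rewrite [X in _ = X - _]e -[X in _ = _ - X]mul1r -s_y; ring.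
have y1 : var_y = s ^+ 2 + 1 by rewrite s2 subrK.
rewrite /Rpde.
(* Since 1 - y = - s^2, the terms in dg/dy combine to - 2 y s^2 dg/dy, a multiple of the quantity in
   [gy]. *)
have -> : g + var_y * (var_x * dx g) + (var_y * dy g) *+ 2
    - (var_y * (var_y * dy g)) *+ 2 =
    g + var_y * (var_x * dx g) - var_y * s * (s * dy g *+ 2).
  by rewrite y1; ring.
have UDD : D * D \is a GRing.unit by rewrite unitrM UD.
apply: (mulIr UDD).
(* Products are regrouped so that [gx], [gy] and then [gD] can eliminate g. *)
transitivity (dx g * D * D); first by ring.
transitivity (g * D * D + var_y * (var_x * (dx g * D * D))
    - var_y * s * ((s * dy g *+ 2) * D * D)); last by ring.
rewrite gx gy.
have -> : g * (s * (s * t + c)) * D = g * D * (s * (s * t + c)) by ring.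
have -> : (1 - g * (c - var_x * (s * t + c))) * D =
  D - g * D * (c - var_x * (s * t + c)) by ring.
by rewrite gD y1 /D; ring.
Qed.

End GeneratingFunction.

Theorem theorem3p5 (C : numClosedFieldType) (s : {fps {fps C}}) :
  s ^+ 2 = var_y - 1 ->
  Rgf = s / (s * (fps_cos \oF (var_x * s)) - (fps_sin \oF (var_x * s))).
Proof.
(* By uniqueness, only the constant terms in x remain to be compared. *)
move=> s2; apply: Rpde_inj; [|exact: Rpde_Rgf|exact: Rpde_closed].
have UD := denominator_unit s2.
have -> : Rgf 0%N = 1 :> {fps C}.
  by apply: fpsP => k; rewrite fps_coef1 /= Rnk0 fact0 divr1.
(* At x = 0 the cosine is 1 and the sine is 0, so the denominator reduces to the constant term of
   s. *)
set D := _ - _ in UD *; have D0 : D 0%N = s 0%N.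
  rewrite fps_coefD fps_coefN fps_coefM0 (sqrt_yB1_const s2) !fps_coef_compXC.
  by rewrite !expr0 /= fact0 divr1 mul0r subr0 !mulr1.
rewrite fps_unitE D0 in UD; apply: (mulIr UD); rewrite mul1r.
by rewrite -{2}D0 -fps_coefM0 divrK // fps_unitE D0.
Qed.
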